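(* The existence of both the sixth Peano derivative $f_{(6)}(x)$ and the seventh Riemann derivative $D_7f(x)$ does not imply the existence of the seventh Peano derivative $f_{(7)}(x)$ for all functions $f$ and points $x$. That is, there exist a function $f:\mathbb{R}\to\mathbb{R}$ and a point $x\in\mathbb{R}$ such that $f_{(6)}(x)$ and $D_7f(x)$ both exist but $f_{(7)}(x)$ does not exist.
   Context: The $n$-th Riemann derivative of $f$ at $x$ is $D_nf(x)=\lim_{h\to 0}\frac1{h^n}\sum_{k=0}^n(-1)^k\binom nk f(x+(n-k)h)$, when this limit exists as a finite real number. $f$ has $n$ Peano derivatives at $x$ (equivalently, the $n$-th Peano derivative $f_{(n)}(x)$ exists) if there are real numbers $f_{(0)}(x):=f(x),f_{(1)}(x),\ldots ,f_{(n)}(x)$ such that $f(x+h)=\sum_{i=0}^n f_{(i)}(x)\frac{h^i}{i!}+o(h^n)$ as $h\to 0$. *)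

(* Defs.v *)
From mathcomp Require Import all_boot all_order all_algebra.
From mathcomp Require Import all_classical all_reals all_analysis.
Import Order.TTheory GRing.Theory Num.Theory.
Import numFieldNormedType.Exports.

Set Implicit Arguments.
Unset Strict Implicit.
Unset Printing Implicit Defensive.

Local Open Scope classical_set_scope.
Local Open Scope ring_scope.

Definition riemann_difference (R : realType) (n : nat) (f : R -> R) (x h : R) : R :=
  \sum_(k < n.+1) (-1) ^+ k * ('C(n, k))%:R * f (x + (n - k)%:R * h).

Definition is_riemann_derivative (R : realType) (n : nat) (f : R -> R) (x l : R) : Prop :=
  riemann_difference n f x h / h ^+ n @[h --> 0^'] --> l.

Definition riemann_derivable (R : realType) (n : nat) (f : R -> R) (x : R) : Prop :=
  exists l : R, is_riemann_derivative n f x l.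

(* Only the values c 0, ..., c n matter. *)
Definition are_peano_derivatives (R : realType) (n : nat) (f : R -> R) (x : R)
    (c : nat -> R) : Prop :=
  c 0%N = f x /\
  (fun h : R => f (x + h) - \sum_(i < n.+1) c i * (h ^+ i / i`!%:R))
    =o_ (0^') (fun h : R => h ^+ n).

Definition peano_derivable (R : realType) (n : nat) (f : R -> R) (x : R) : Prop :=
  exists c : nat -> R, are_peano_derivatives n f x c.

(* Main.v *)
Require Import Defs.
From mathcomp Require Import all_boot all_order all_algebra.
From mathcomp Require Import all_classical all_reals all_analysis.
From mathcomp Require Import ring lra.
Import Order.TTheory GRing.Theory Num.Theory.
Import numFieldNormedType.Exports.

(** Take [f x = chi x * x ^ s], where [chi] is the completely multiplicative
    sign on the positive rationals with [chi 2 = chi 5 = -1] and [chi p = 1]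
    for the other primes [p], extended by 0 to all other reals. Then
    [f (k h) = chi k * k ^ s * f h] for every [h] and every integer [k > 0], so
    the seventh Riemann difference of [f] at 0 is [F s * f h] with
    [F s = 7 + 21 2^s + 35 3^s - 35 4^s - 21 5^s + 7 6^s + 7^s].
    As [F 6 = -378] and [F 7 = 648270], some [s] in [(6, 7)] makes this
    difference vanish identically. Since [|f h| <= |h| ^ s] with [s > 6], all
    Peano derivatives up to order 6 are 0. An expansion of order 7 would have
    zero coefficients because [f] vanishes on the negative axis, contradicting
    [|f (1/n)| = n ^ (-s) >= n ^ (-7)]. *)

Set Implicit Arguments.
Unset Strict Implicit.
Unset Printing Implicit Defensive.

Local Open Scope classical_set_scope.
Local Open Scope ring_scope.

Definition weight (n : nat) : nat := (logn 2 n + logn 5 n)%N.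

Lemma weightM (m n : nat) :
  (0 < m)%N -> (0 < n)%N -> weight (m * n) = (weight m + weight n)%N.
Proof. by move=> m0 n0; rewrite /weight !lognM// addnACA. Qed.

(** The parity of [weight m + weight n] is that of the difference, hence the sign exponent of the
    fraction. Unreduced fractions are allowed, so that scaling by [k] just multiplies a numerator or
    a denominator. *)
Definition weight_class (R : realType) (b : bool) : set R :=
  [set x | exists m n : nat,
    [/\ (0 < m)%N, (0 < n)%N, x = m%:R / n%:R
      & odd (weight m + weight n) = b]].

Arguments weight_class : clear implicits.

Definition chi (R : realType) (x : R) : R :=
  \1_(weight_class R false) x - \1_(weight_class R true) x.

Section chi.
Variable R : realType.
Implicit Types x : R.

Lemma weight_class_gt0 b x : weight_class R b x -> 0 < x.
Proof. by move=> [m [n [m0 n0 -> _]]]; rewrite divr_gt0 ?ltr0n. Qed.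

Lemma weight_classM k b x : (0 < k)%N ->
  weight_class R b (k%:R * x) = weight_class R (b (+) odd (weight k)) x.
Proof.
move=> k0; have kn0 : k%:R != 0 :> R by rewrite pnatr_eq0 -lt0n.
apply/propext; split => -[m [n [m0 n0 xE bE]]].
- exists m, (k * n)%N; split; rewrite ?muln_gt0 ?k0//.
    by rewrite -[LHS](mulKf kn0) xE natrM invfM mulrCA.
  by rewrite weightM// addnCA oddD bE addbC.
- exists (k * m)%N, n; split; rewrite ?muln_gt0 ?k0//.
    by rewrite xE natrM mulrA.
  by rewrite weightM// -addnA oddD bE addbC addbK.
Qed.

(** Scaling by [k] preserves both classes if [weight k] is even and swaps them if it is odd. *)
Lemma chiM k x : (0 < k)%N -> chi (k%:R * x) = (-1) ^+ weight k * chi x.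
Proof.
move=> k0; have memM b :
    (k%:R * x \in weight_class R b)
    = (x \in weight_class R (b (+) odd (weight k))).
  by apply/idP/idP; rewrite !inE weight_classM.
rewrite /chi !indicE !memM -signr_odd.
by case: odd; rewrite /= ?expr1 ?expr0 ?mul1r// mulN1r opprB.
Qed.

Lemma chi1 : chi (1 : R) = 1.
Proof.
rewrite /chi !indicE mem_set ?memNset ?subr0//.
  (* A fraction equal to 1 has [m = n], so its weight sum is even. *)
  move=> [m [n [m0 n0 /esym/divr1_eq/eqP]]].
  rewrite eqr_nat => /eqP ->.
  by rewrite addnn odd_double.
by exists 1%N, 1%N; split=> //; rewrite divr1.
Qed.

Lemma norm_chi_inv n : `|chi (n.+1%:R^-1 : R)| = 1.
Proof.
have := chi1.
rewrite -[1](@mulfV R n.+1%:R) ?pnatr_eq0// chiM// => /(congr1 Num.norm).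
by rewrite normrM normrX normrN1 expr1n mul1r mulfV ?pnatr_eq0// normr1.
Qed.

Lemma chi_le0 x : x <= 0 -> chi x = 0.
Proof.
move=> x0; rewrite /chi !indicE !memNset ?subr0// => /weight_class_gt0;
by rewrite ltNge x0.
Qed.

Lemma norm_chi_le1 x : `|chi x| <= 1.
Proof.
rewrite /chi !indicE; do 2 case: (_ \in _);
by rewrite ?subr0 ?subrr ?sub0r ?normrN ?normr1 ?normr0.
Qed.

End chi.

Section littleo.
Variable R : realType.

Lemma eqo_exprP (f : R -> R) n :
  f =o_ (0^') (fun h => h ^+ n) <-> f h / h ^+ n @[h --> 0^'] --> 0.
Proof.
have normE (h e : R) : h != 0 ->
    (`|f h / h ^+ n| <= e) = (`|f h| <= e * `|h ^+ n|).
  by move=> h0; rewrite normrM normfV ler_pdivrMr// normr_gt0 expf_neq0.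
split=> [/eqoP fo|fo].
- apply/cvgr0Pnorm_le => e e0; have := fo _ e0.
  apply: filterS2 (nbhs_dnbhs_neq _) => h h0 fh.
  by rewrite normE.
- apply/eqoP => e e0; have /cvgr0Pnorm_le/(_ _ e0) := fo.
  by apply: filterS2 (nbhs_dnbhs_neq _) => h h0; rewrite normE.
Qed.

(** By induction on [n]: multiplying the quotient by a power of [h] shows that 0 is a root, and
    dividing out ['X] lowers both the size and the order. The limit is one-sided because it will be
    used where [f] vanishes. *)
Lemma poly_littleo_eq0 n (p : {poly R}) : (size p <= n.+1)%N ->
  p.[h] / h ^+ n @[h --> 0^'-] --> 0 -> p = 0.
Proof.
have neq0 : \forall h \near (0 : R)^'-, h != 0.
  by near=> h; rewrite lt_eqF//; near: h; exact: nbhs_left_lt.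
elim: n p => [|n IHn] p sp p_o.
  rewrite (size1_polyC sp); congr polyC.
  apply: cvg_unique p_o => //.
  apply: cvg_near_cst; near=> h.
  by rewrite expr0 divr1 {1}(size1_polyC sp) hornerC.
have /factor_theorem[q pE] : root p 0.
  apply/eqP; apply: (@cvg_unique _ _ (p.[h] @[h --> 0^'-])) => //.
  - by apply: cvg_at_left_filter; exact: continuous_horner.
  - have /cvg_at_left_filter h_cvg := @exprn_continuous R n.+1 0.
    have /= : p.[h] / h ^+ n.+1 * h ^+ n.+1 @[h --> 0^'-] -->
        (0 * 0 ^+ n.+1 : R).
      exact: cvgM.
    rewrite mul0r; apply: cvg_trans; apply: near_eq_cvg; near=> h => /=.
    by rewrite divfK// expf_neq0//; near: h.
rewrite pE subr0 in sp p_o *.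
have [->|q0] := eqVneq q 0; first by rewrite mul0r.
rewrite (IHn q) ?mul0r//; first by rewrite size_mulX in sp.
apply: cvg_trans p_o; apply: near_eq_cvg; near=> h.
rewrite hornerM hornerX exprSr -mulf_div divff ?mulr1//.
Unshelve. all: by end_near. Qed.

End littleo.

Section exponent.
Variable R : realType.

Lemma powR_continuousr (a : R) : 0 < a -> continuous (fun s : R => a `^ s).
Proof.
move=> a0 s; rewrite /powR; under eq_fun do rewrite gt_eqF//.
apply: continuous_comp; last exact: continuous_expR.
by apply: cvgM; [exact: cvg_id|exact: cvg_cst].
Qed.

(** The coefficient of [j ^ s] is [(-1) ^ (7 - j) * 'C(7, j) * chi j]. The bound [6 < s] serves the
    sixth Peano derivative, and [s <= 7] rules out the seventh. *)
Lemma riemann_exponent : exists2 s : R, 6 < s <= 7 &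
  7 + 21 * 2 `^ s + 35 * 3 `^ s - 35 * 4 `^ s - 21 * 5 `^ s + 7 * 6 `^ s
  + 7 `^ s = 0.
Proof.
pose F (s : R) : R := 7 + 21 * 2 `^ s + 35 * 3 `^ s - 35 * 4 `^ s - 21 * 5 `^ s
  + 7 * 6 `^ s + 7 `^ s.
have F6 : F 6 < 0 by rewrite /F !(powR_mulrn _ (ler0n _ _)); lra.
have F7 : 0 < F 7 by rewrite /F !(powR_mulrn _ (ler0n _ _)); lra.
have [|||s] := @IVT R F 6 7 0.
- by rewrite ler_nat.
- apply: continuous_subspaceT => s; rewrite /F.
  have kpow (k a : R) (a0 : 0 < a) :
      {for s, continuous (fun t : R => k * a `^ t)}.
    by apply: cvgM; [exact: cvg_cst|exact: powR_continuousr].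
  apply: cvgD; last by apply: powR_continuousr; rewrite ltr0n.
  apply: cvgD; last by apply: kpow; rewrite ltr0n.
  apply: cvgB; last by apply: kpow; rewrite ltr0n.
  apply: cvgB; last by apply: kpow; rewrite ltr0n.
  apply: cvgD; last by apply: kpow; rewrite ltr0n.
  apply: cvgD; last by apply: kpow; rewrite ltr0n.
  exact: cvg_cst.
- by rewrite ge_min le_max (ltW F6) (ltW F7) orbT.
rewrite in_itv /= => /andP[s6 s7] Fs; exists s => //.
rewrite s7 andbT lt_neqAle s6 andbT; apply/eqP => sE.
by move: F6; rewrite sE Fs ltxx.
Qed.

End exponent.

Theorem theorem3p1 (R : realType) :
  exists (f : R -> R) (x : R),
    [/\ peano_derivable 6 f x,
        riemann_derivable 7 f x &
        ~ peano_derivable 7 f x].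
Proof.
have [s /andP[s6 s7] sE] := riemann_exponent R.
pose f (x : R) := chi x * x `^ s.
have f_le0 x : x <= 0 -> f x = 0 by move=> x0; rewrite /f chi_le0 ?mul0r.
have fM k x : (0 < k)%N -> f (k%:R * x) = (-1) ^+ weight k * k%:R `^ s * f x.
  move=> k0; have [x0|x0] := leP x 0.
    by rewrite (f_le0 x)// mulr0 f_le0// mulr_ge0_le0.
  by rewrite /f chiM// powRM ?ler0n ?ltW// mulrACA.
exists f, 0; split.
- exists (fun=> 0); split; first by rewrite f_le0.
  apply/eqo_exprP.
  suff f_o : f h / h ^+ 6 @[h --> 0^'] --> 0.
    apply: cvg_trans f_o; apply: near_eq_cvg; near=> h.
    by rewrite add0r big1 ?subr0// => i _; rewrite mul0r.
  apply/cvgr0Pnorm_le => e e0.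
  (* For [h > 0] the quotient is at most [h ^ (s - 6)] in absolute value; the radius [d] also serves
     [h <= 0], where [f] vanishes. *)
  have /powR_cvg0/cvgr0Pnorm_le/(_ _ e0)[d /= d0 dP] : 0 < s - 6.
    by rewrite subr_gt0.
  exists d => //= h hd _; have [h0|h0] := leP h 0.
    by rewrite f_le0// mul0r normr0 ltW.
  apply: le_trans (dP _ hd h0).
  rewrite /f powRB ?(gt_eqF h0) ?implybT// (powR_mulrn _ (ltW h0)).
  by rewrite !normrM -mulrA ler_piMl ?norm_chi_le1.
- exists 0; apply: cvg_near_cst; near=> h.
  rewrite /riemann_difference !big_ord_recr big_ord0 /= !add0r.
  rewrite !subSS !subn0 mul0r (f_le0 0)// mulr0 addr0 (mul1r h).
  rewrite (fM 2%N)// (fM 3%N)// (fM 4%N)// (fM 5%N)// (fM 6%N)// (fM 7%N)//.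
  have [-> -> ->] : [/\ weight 2 = 1, weight 3 = 0 & weight 4 = 2]%N by [].
  have [-> -> ->] : [/\ weight 5 = 1, weight 6 = 1 & weight 7 = 0]%N by [].
  rewrite bin0 bin1 (_ : 'C(7, 2) = 21%N)// (_ : 'C(7, 3) = 35%N)//.
  rewrite (_ : 'C(7, 4) = 35%N)// (_ : 'C(7, 5) = 21%N)//.
  rewrite (_ : 'C(7, 6) = 7%N)//.
  (* The numerator is the left side of [sE] times [f h]. *)
  apply/eqP; rewrite mulf_eq0; apply/orP; left; apply/eqP.
  by rewrite -[RHS](mul0r (f h)) -sE; ring.
- move=> [c [_ /eqo_exprP c_o]].
  pose p := \poly_(i < 8) (c i / i`!%:R).
  have pE h : \sum_(i < 8) c i * (h ^+ i / i`!%:R) = p.[h].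
    by rewrite horner_poly; apply: eq_bigr => i _; rewrite mulrCA mulrC.
  have p0 : p = 0.
    apply: (@poly_littleo_eq0 _ 7); first exact: size_poly.
    (* To the left of 0 the remainder is [- p.[h]], so negating the limit gives the one for [p]. *)
    have /cvg_dnbhs_at_left/cvgN := c_o.
    rewrite oppr0; apply: cvg_trans; apply: near_eq_cvg; near=> h.
    have h0 : h <= 0 by near: h; exact: nbhs_left_le.
    by rewrite fctE /= add0r pE f_le0// sub0r mulNr opprK.
  (* With [p = 0], the quotient [f h / h ^ 7] must have absolute value below 1 for small [h > 0]; at
     [h = 1 / (n + 1)] it is [h ^ (s - 7)], which is at least 1. *)
  have /cvg_dnbhs_at_right/cvgr0_norm_lt/(_ _ ltr01) := c_o.
  move=> [e /= e0 he].
  have [n _ /(_ _ (leqnn n)) ne] : \forall n \near \oo, harmonic n < e.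
    exact: (cvgr_lt _ cvg_harmonic).
  have n0 : 0 < n.+1%:R^-1 :> R by rewrite invr_gt0 ltr0n.
  have := he n.+1%:R^-1.
  rewrite /= sub0r normrN gtr0_norm// => /(_ ne n0); apply/negP; rewrite -leNgt.
  rewrite add0r pE p0 horner0 subr0 normrM normrM norm_chi_inv mul1r.
  rewrite normfV normrX (gtr0_norm n0) ger0_norm ?powR_ge0//.
  rewrite ler_pdivlMr ?exprn_gt0// mul1r -(powR_mulrn _ (ltW n0)).
  by rewrite ger_powR// n0 invf_le1 ?ltr0n// ler1n.
Unshelve. all: by end_near. Qed.
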